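(* Let $\mathcal{H}$ be a real Hilbert space, let $V\subseteq\mathcal{H}$ be a closed vector subspace, and let $T:\mathcal{H}\rightrightarrows\mathcal{H}$ be a maximal monotone operator for which there exist $\eta>0$ and $L>0$ such that $$\langle z-z',v-v'\rangle\ge \eta\|z-z'\|^2\quad\text{and}\quad \|v-v'\|\le L\|z-z'\|\qquad \forall\, v\in T(z),\ v'\in T(z').$$ Let $x_0\in V$, $y_0\in V^\perp$ and $\gamma>0$, and let $\{x_k\}$, $\{y_k\}$, $\{\tilde x_k\}$, $\{u_k\}$ be generated by the SPDG algorithm (described in the context) from this data. Let $(x^*,u^* )$ be the (unique) pair in $\mathcal{H}\times\mathcal{H}$ satisfying $x^*\in V$, $u^*\in V^\perp$ and $u^*\in T(x^* )$, and let $$d_0:=\sqrt{\|x^*-x_0\|^2+\gamma^2\|u^*-y_0\|^2}.$$ Then, for all $k\ge 1$, $$\|x_{k-1}-x_k\|^2+\gamma^2\|y_{k-1}-y_k\|^2\le\left(1-\frac{2\gamma\eta}{(1+\gamma L)^2-2\gamma(L-\eta)}\right)^{k-1}d_0^{2},$$ $$\|\tilde x_k-P_V(\tilde x_k)\|^2+\gamma^2\|u_k-P_{V^\perp}(u_k)\|^2\le\left(1-\frac{2\gamma\eta}{(1+\gamma L)^2-2\gamma(L-\eta)}\right)^{k-1}d_0^{2},$$ $$\|x^*-x_k\|^2+\gamma^2\|u^*-y_k\|^2\le\left(1-\frac{2\gamma\eta}{(1+\gamma L)^2-2\gamma(L-\eta)}\right)^{k}d_0^{2}.$$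
   Context: A set-valued map $T:\mathcal{H}\rightrightarrows\mathcal{H}$ is monotone if $\langle z-z',v-v'\rangle\ge0$ for all $v\in T(z)$, $v'\in T(z')$; it is maximal monotone if moreover its graph $G(T)=\{(z,v)\in\mathcal{H}\times\mathcal{H} : v\in T(z)\}$ is not properly contained in the graph of any other monotone operator on $\mathcal{H}$. For $\gamma>0$, $(\gamma T)(z)=\{\gamma v : v\in T(z)\}$. For a maximal monotone operator $S$, the resolvent $(S+I)^{-1}$ is an everywhere-defined single-valued map, with $z=(S+I)^{-1}x$ if and only if $x-z\in S(z)$. $P_V$ and $P_{V^\perp}$ denote the orthogonal projections onto $V$ and $V^\perp$. SPDG algorithm: given $x_0\in V$, $y_0\in V^\perp$ and $\gamma>0$, for $k=1,2,\dots$: (1) compute $$\tilde x_k=(\gamma T+I)^{-1}(x_{k-1}+\gamma y_{k-1}),\qquad u_k=\gamma^{-1}(x_{k-1}+\gamma y_{k-1}-\tilde x_k);$$ (2) if $\tilde x_k\in V$ and $u_k\in V^\perp$, stop; otherwise set $$x_k=P_V(\tilde x_k),\qquad y_k=P_{V^\perp}(u_k),$$ and continue with $k+1$. If the algorithm stops, ''for all $k\ge1$'' refers to all $k\ge 1$ for which the iterates involved have been generated. *)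

(* Defs.v *)
From HB Require Import structures.
From mathcomp Require Import all_boot all_order all_algebra.
From mathcomp Require Import all_classical all_reals all_analysis.

Set Implicit Arguments.
Unset Strict Implicit.
Unset Printing Implicit Defensive.

Import Order.TTheory GRing.Theory Num.Theory.
Import numFieldNormedType.Exports.
Local Open Scope classical_set_scope.
Local Open Scope ring_scope.

(* A real Hilbert space is a [completeNormedModType R] whose norm is the one
   induced by a positive definite symmetric bilinear form: over [idfun], the
   sesquilinear structure [{dot H for idfun}] is bilinear and symmetric. *)
Definition norm_induced_by (R : realType) (H : completeNormedModType R)
    (dot : {dot H for (@idfun R)}) : Prop :=
  forall x : H, `|x| ^+ 2 = dot x x.

Section Operators.
Variables (R : realType) (H : completeNormedModType R).
Variable dot : {dot H for (@idfun R)}.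

Definition closed_subspace (V : set H) : Prop :=
  closed V /\ GRing.submod_closed [in V].

Definition orthogonal_complement (V : set H) : set H :=
  [set w | forall v, V v -> dot v w = 0].

(* The default value 0 of [xget] is never used when [V] is a closed subspace. *)
Definition orthogonal_projection (V : set H) (x : H) : H :=
  xget 0 [set p | V p /\ orthogonal_complement V (x - p)].

Definition graph (T : H -> set H) : set (H * H) := [set p | T p.1 p.2].

Definition monotone_operator (T : H -> set H) : Prop :=
  forall z z' v v', T z v -> T z' v' -> 0 <= dot (z - z') (v - v').

Definition maximal_monotone (T : H -> set H) : Prop :=
  monotone_operator T /\
  forall S : H -> set H, monotone_operator S -> ~ (graph T `<` graph S).

Definition scale_operator (c : R) (T : H -> set H) : H -> set H :=
  fun z => [set c *: v | v in T z].

(* (S + I)^-1 as a set-valued map; [S] maximal monotone makes it single-valued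
   and everywhere defined. *)
Definition resolvent (S : H -> set H) (x : H) : set H := [set z | S z (x - z)].

Section SPDG.
Variables (V : set H) (T : H -> set H) (gamma : R) (x0 y0 : H).
Variables x y xt u : nat -> H.

Definition spdg_stops (k : nat) : Prop :=
  V (xt k) /\ orthogonal_complement V (u k).

(* Iteration k is carried out: the algorithm did not stop before.  It produces
   xt k and u k; it produces x k and y k only if it does not stop there, that
   is, if [spdg_executed k.+1]. *)
Definition spdg_executed (k : nat) : Prop :=
  forall j, (1 <= j < k)%N -> ~ spdg_stops j.

(* The sequences are total, but their values at indices that the algorithm does
   not reach are unconstrained; [xt 0] and [u 0] are junk. *)
Record spdg_generated : Prop := SpdgGenerated {
  spdg_x0 : x 0%N = x0;
  spdg_y0 : y 0%N = y0;
  spdg_xt : forall k, (1 <= k)%N -> spdg_executed k ->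
    resolvent (scale_operator gamma T) (x k.-1 + gamma *: y k.-1) (xt k);
  spdg_u : forall k, (1 <= k)%N -> spdg_executed k ->
    u k = gamma^-1 *: (x k.-1 + gamma *: y k.-1 - xt k);
  spdg_x : forall k, (1 <= k)%N -> spdg_executed k.+1 ->
    x k = orthogonal_projection V (xt k);
  spdg_y : forall k, (1 <= k)%N -> spdg_executed k.+1 ->
    y k = orthogonal_projection (orthogonal_complement V) (u k)
}.

End SPDG.
End Operators.

(* Main.v *)
(** Since [xt k + gamma u k = x (k-1) + gamma y (k-1)], the squared distance
    [s k] from [(x k, gamma y k)] to [(xs, gamma us)] is that of the point
    [x k + gamma y k] to [xs + gamma us], by orthogonality of [V] and its
    complement.  With [a = xs - xt k] and [b = us - u k],
    [s (k-1) = |a|^2 + gamma^2 |b|^2 + 2 gamma <a, b>], while Pythagoras on [V]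
    and on its complement gives
    [s k + e k = |a|^2 + gamma^2 |b|^2], where [e k] is the left-hand side of
    the second bound, which is also that of the first one.  Strong monotonicity
    and the Lipschitz bound turn the gain [2 gamma <a, b>] into a fixed fraction
    of [s (k-1)]. *)
Require Import Defs.
From HB Require Import structures.
From mathcomp Require Import all_boot all_order all_algebra.
From mathcomp Require Import all_classical all_reals all_analysis.
From mathcomp Require Import ring lra.

Set Implicit Arguments.
Unset Strict Implicit.
Unset Printing Implicit Defensive.

Import Order.TTheory GRing.Theory Num.Theory.
Import numFieldNormedType.Exports.
Local Open Scope classical_set_scope.
Local Open Scope ring_scope.

(** * Bilinearity, orthogonality and uniqueness of projections *)

Section Projection.
Variables (R : realType) (H : completeNormedModType R).
Variables (dot : {dot H for (@idfun R)}) (Hdot : norm_induced_by dot).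
Implicit Types (x y z p v : H) (V W : set H).

Local Notation perp := (orthogonal_complement dot).
Local Notation proj := (orthogonal_projection dot).

Lemma dotC x y : dot x y = dot y x.
Proof. by rewrite hermC /= expr0 mul1r. Qed.

Lemma dotDl x y z : dot (x + y) z = dot x z + dot y z.
Proof. exact: linearDl. Qed.

Lemma dotDr x y z : dot x (y + z) = dot x y + dot x z.
Proof. exact: linearDr. Qed.

Lemma dotNr x y : dot x (- y) = - dot x y.
Proof. exact: linearNr. Qed.

Lemma dotBr x y z : dot x (y - z) = dot x y - dot x z.
Proof. exact: linearBr. Qed.

Lemma dotBl x y z : dot (x - y) z = dot x z - dot y z.
Proof. exact: linearBl. Qed.

Lemma dotZr (a : R) x y : dot x (a *: y) = a * dot x y.
Proof. exact: linearZr_LR. Qed.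

Lemma normD_sqr x y : `|x + y| ^+ 2 = `|x| ^+ 2 + 2 * dot x y + `|y| ^+ 2.
Proof. by rewrite !Hdot dotDl !dotDr (dotC y x); ring. Qed.

Lemma normZ_sqr (a : R) x : `|a *: x| ^+ 2 = a ^+ 2 * `|x| ^+ 2.
Proof. by rewrite normrZ exprMn real_normK ?num_real. Qed.

Lemma normD_sqr_orth x y : dot x y = 0 ->
  `|x + y| ^+ 2 = `|x| ^+ 2 + `|y| ^+ 2.
Proof. by move=> xy0; rewrite normD_sqr xy0 mulr0 addr0. Qed.

Lemma parallelogram x y :
  `|x + y| ^+ 2 + `|x - y| ^+ 2 = 2 * `|x| ^+ 2 + 2 * `|y| ^+ 2.
Proof. by rewrite !normD_sqr dotNr normrN; ring. Qed.

Lemma perp_lincomb V (a : R) x y : perp V x -> perp V y -> perp V (a *: x + y).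
Proof.
by move=> Vx Vy v Vv; rewrite dotDr dotZr Vx// Vy// mulr0 addr0.
Qed.

Lemma sub_perp_perp V v : V v -> perp (perp V) v.
Proof. by move=> Vv w Vw; rewrite dotC Vw. Qed.

(** If [xget] selects [q], then [q - p = (x - p) - (x - q)] is orthogonal to both [p] and [q], hence
    to itself. The set [W] is arbitrary, so this applies to [V] and to its complement alike. *)
Lemma orthogonal_projection_unique W x p :
  W p -> perp W (x - p) -> proj W x = p.
Proof.
move=> Wp Wxp; rewrite /orthogonal_projection.
case: xgetP => [q _ [Wq Wxq]|/(_ p)]; last by case.
apply/eqP; rewrite -subr_eq0 -normr_eq0 -sqrf_eq0 Hdot dotBl.
have -> : q - p = (x - p) - (x - q) by rewrite opprB [RHS]addrC addrA subrK.
by rewrite (dotBr q) (dotBr p) Wxp// Wxq// Wxp// Wxq// !subr0.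
Qed.

(** * Projection theorem and Pythagoras for a closed subspace *)

Section ClosedSubspace.
Variables (V : set H) (HV : closed_subspace V).

Lemma subspace0 : V 0.
Proof. by case: HV => _ [/set_mem]. Qed.

Lemma subspace_lincomb (a : R) x y : V x -> V y -> V (a *: x + y).
Proof.
by case: HV => _ [_ lin] Vx Vy; apply: set_mem; apply: lin; apply: mem_set.
Qed.

Lemma nearest_point_orthogonal x p :
  V p -> (forall v, V v -> `|x - p| ^+ 2 <= `|x - v| ^+ 2) -> perp V (x - p).
Proof.
move=> Vp pmin v Vv; set w := x - p.
have [->|v0] := eqVneq v 0; first by rewrite linear0l.
have v2 : 0 < `|v| ^+ 2 by rewrite exprn_gt0// normr_gt0.
(* The coefficient [dot v w / |v|^2] minimizes [|w - c v|^2] over [c]; the decrease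
   [(dot v w)^2 / |v|^2] must then be nonpositive. *)
have := pmin _ (subspace_lincomb (dot v w / `|v| ^+ 2) Vv Vp).
rewrite (_ : x - (_ + p) = w + (- (dot v w / `|v| ^+ 2)) *: v); last first.
  by rewrite scaleNr opprD addrCA addrC.
rewrite -/w normD_sqr normZ_sqr dotZr (dotC w v) => le_w.
have : dot v w ^+ 2 / `|v| ^+ 2 <= 0.
  rewrite -[leLHS](_ : - (2 * (- (dot v w / `|v| ^+ 2) * dot v w)
      + (- (dot v w / `|v| ^+ 2)) ^+ 2 * `|v| ^+ 2) = _).
    by lra.
  by field; rewrite normr_eq0.
rewrite pmulr_lle0 ?invr_gt0// => le0.
by apply/eqP; rewrite -sqrf_eq0 eq_le le0 sqr_ge0.
Qed.

(** A minimizing sequence in [V] is Cauchy by the parallelogram law; completeness gives a limit,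
    which closedness keeps in [V]. *)
Lemma nearest_point_exists x :
  exists2 p, V p & forall v, V v -> `|x - p| ^+ 2 <= `|x - v| ^+ 2.
Proof.
pose E : set R := [set `|x - v| ^+ 2 | v in V].
have Elb : has_lbound E by exists 0 => _ [v _ <-]; rewrite sqr_ge0.
have Einf : has_inf E by split=> //; exists (`|x - 0| ^+ 2), 0 => //; apply: subspace0.
pose d : R := inf E.
have dmin v : V v -> d <= `|x - v| ^+ 2 :> R by move=> Vv; apply: ge_inf => //; exists v.
have /choice[f fP] n : exists v, V v /\ `|x - v| ^+ 2 < d + n.+1%:R^-1 :> R.
  have n_gt0 : 0 < n.+1%:R^-1 :> R by rewrite invr_gt0 ltr0n.
  have [_ [v Vv <-] lt_v] := inf_adherent n_gt0 Einf.
  by exists v.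
have fV n : V (f n) by case: (fP n).
have f_close m n :
    `|f m - f n| ^+ 2 <= 2 * m.+1%:R^-1 + 2 * n.+1%:R^-1 :> R.
  have := parallelogram (x - f n) (x - f m).
  rewrite (_ : x - f n - _ = f m - f n); last first.
    by rewrite opprB [LHS]addrC addrA subrK.
  (* The midpoint of [f n] and [f m] lies in [V], so its squared distance to [x] is at least [d];
     this bounds [|f m - f n|^2] from above. *)
  have -> : x - f n + (x - f m) = 2 *: (x - (2^-1 *: f n + 2^-1 *: f m)).
    rewrite scalerBr -scalerDr scalerA divff// scale1r scaler_nat mulr2n.
    by rewrite opprD addrACA.
  rewrite normZ_sqr => par.
  have := dmin _ (subspace_lincomb 2^-1 (fV n)
    (subspace_lincomb 2^-1 (fV m) subspace0)).
  rewrite addr0 => mid.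
  have arith (a b c e s t : R) : 2 ^+ 2 * c + e = 2 * a + 2 * b ->
    d <= c -> a < d + s -> b < d + t -> e <= 2 * t + 2 * s by lra.
  exact: arith par mid (fP n).2 (fP m).2.
have f_cvg : cvg (f n @[n --> \oo]).
  apply: cauchy_cvg; apply: cauchy_exP => e e0.
  (* Two terms [2 / (n + 1)] below [e^2 / 2] each make the bound of [f_close] smaller than [e^2]. *)
  have e2 : 0 < e ^+ 2 / 4 by rewrite divr_gt0// exprn_gt0.
  have [N _ Ne] := near_infty_natSinv_lt (PosNum e2).
  exists (f N), N => // n /= Nn; rewrite -ball_normE /=.
  rewrite -(ltr_pXn2r (n := 2)) ?nnegrE ?normr_ge0 ?(ltW e0)//.
  have arith (a s t : R) : a <= 2 * s + 2 * t -> s < e ^+ 2 / 4 ->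
    t < e ^+ 2 / 4 -> a < e ^+ 2 by lra.
  exact: arith (f_close N n) (Ne _ (leqnn N)) (Ne _ Nn).
have Vp : V (lim (f n @[n --> \oo])).
  by apply: (closed_cvg V HV.1 _ _ f_cvg); apply: nearW.
exists (lim (f n @[n --> \oo])) => // v /dmin; apply: le_trans.
have cvg_f : (`|x - f n| ^+ 2) @[n --> \oo] --> `|x - lim (f n @[n --> \oo])| ^+ 2.
  have h : `|x - f n| @[n --> \oo] --> `|x - lim (f n @[n --> \oo])|.
    by apply: cvg_norm; apply: cvgB => //; apply: cvg_cst.
  by rewrite expr2; under eq_fun do rewrite expr2; apply: cvgM.
have cvg_d : (d + n.+1%:R^-1) @[n --> \oo] --> d.
  by rewrite -[X in _ --> X]addr0; apply: cvgD; [apply: cvg_cst|apply: cvg_harmonic].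
apply: (ler_cvg_to cvg_f cvg_d).
by apply: nearW => n; apply: ltW; case: (fP n).
Qed.

Lemma orthogonal_projectionP x : V (proj V x) /\ perp V (x - proj V x).
Proof.
have [p Vp pmin] := nearest_point_exists x.
have Vxp := nearest_point_orthogonal Vp pmin.
by rewrite (orthogonal_projection_unique Vp Vxp).
Qed.

(** The remainder of [x - proj V x] is [proj V x], which lies in [V] and hence in the double
    complement; uniqueness concludes. *)
Lemma orthogonal_projection_perp x : proj (perp V) x = x - proj V x.
Proof.
have [Vp Vxp] := orthogonal_projectionP x.
by apply: orthogonal_projection_unique => //; rewrite subKr; apply: sub_perp_perp.
Qed.

(** This is linearity of the projection applied to [z + c t = x + y], obtained from uniqueness. *)
Lemma orthogonal_projection_split x y z t (c : R) : V x -> perp V y ->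
  z + c *: t = x + y -> proj V z + c *: proj V t = x.
Proof.
move=> Vx Vy zt; have [Vz Vz'] := orthogonal_projectionP z.
have [Vt Vt'] := orthogonal_projectionP t.
have <- : proj V (x + y) = x.
  by apply: orthogonal_projection_unique => //; rewrite addrC addKr.
rewrite addrC; apply/esym/orthogonal_projection_unique.
  exact: subspace_lincomb.
have -> : x + y - (c *: proj V t + proj V z)
    = c *: (t - proj V t) + (z - proj V z).
  by rewrite -zt scalerBr addrACA -opprD [z + _]addrC.
exact: perp_lincomb.
Qed.

Lemma pythagoras_projection v x : V v ->
  `|v - proj V x| ^+ 2 + `|x - proj V x| ^+ 2 = `|v - x| ^+ 2.
Proof.
move=> Vv; have [Vp Vxp] := orthogonal_projectionP x.
have -> : v - x = (v - proj V x) + - (x - proj V x).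
  by rewrite opprB addrA subrK.
rewrite (normD_sqr_orth (x := v - proj V x)) ?normrN// dotNr Vxp ?oppr0//.
by rewrite addrC -scaleN1r; apply: subspace_lincomb.
Qed.

Lemma pythagoras_projection_perp w x : perp V w ->
  `|w - proj (perp V) x| ^+ 2 + `|x - proj (perp V) x| ^+ 2 = `|w - x| ^+ 2.
Proof.
move=> Vw; rewrite orthogonal_projection_perp subKr.
have [Vp Vxp] := orthogonal_projectionP x.
have -> : w - x = (w - (x - proj V x)) + - proj V x.
  by rewrite opprB !addrA addrAC addrK.
rewrite (normD_sqr_orth (y := - proj V x)) ?normrN// dotNr dotC dotBr Vw// Vxp//.
by rewrite subr0 oppr0.
Qed.

End ClosedSubspace.

(** * Norm identities for a single iteration *)

Section OneStep.
Variables (V : set H) (HV : closed_subspace V) (gamma : R) (x y z t : H).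
Hypotheses (Vx : V x) (Vy : perp V y) (zt : z + gamma *: t = x + gamma *: y).

Let perp_gy : perp V (gamma *: y).
Proof. by move=> v Vv; rewrite dotZr Vy// mulr0. Qed.

(** The two terms are exchanged: [x - proj V z] is [gamma] times the residual of [t], and [gamma]
    times the [y] difference is the residual of [z]. *)
Lemma step_norm :
  `|x - proj V z| ^+ 2 + gamma ^+ 2 * `|y - proj (perp V) t| ^+ 2 =
  `|z - proj V z| ^+ 2 + gamma ^+ 2 * `|t - proj (perp V) t| ^+ 2.
Proof.
have splitE := orthogonal_projection_split HV Vx perp_gy zt.
have x_diff : x - proj V z = gamma *: proj V t.
  by rewrite -[X in X - _]splitE addrC addKr.
have y_diff : gamma *: (y - (t - proj V t)) = z - proj V z.
  have -> : gamma *: (y - (t - proj V t)) = gamma *: y - (gamma *: t - (x - proj V z)).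
    by rewrite x_diff !scalerBr.
  have -> : gamma *: y = z + gamma *: t - x by rewrite zt addrC addKr.
  by rewrite opprB !addrA subrK addrAC addrK.
rewrite -!normZ_sqr orthogonal_projection_perp// subKr y_diff x_diff.
exact: addrC.
Qed.

Lemma step_distance xs us : V xs -> perp V us ->
  `|xs - proj V z| ^+ 2 + gamma ^+ 2 * `|us - proj (perp V) t| ^+ 2 +
  (`|z - proj V z| ^+ 2 + gamma ^+ 2 * `|t - proj (perp V) t| ^+ 2) =
  `|xs - z| ^+ 2 + gamma ^+ 2 * `|us - t| ^+ 2.
Proof.
move=> Vxs Vus.
by rewrite addrACA -mulrDr pythagoras_projection// pythagoras_projection_perp.
Qed.

Lemma distance_expand xs us : V xs -> perp V us ->
  `|xs - x| ^+ 2 + gamma ^+ 2 * `|us - y| ^+ 2 =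
  `|xs - z| ^+ 2 + gamma ^+ 2 * `|us - t| ^+ 2
    + 2 * gamma * dot (xs - z) (us - t).
Proof.
move=> Vxs Vus; rewrite -!normZ_sqr -normD_sqr_orth.
  rewrite (_ : xs - x + _ = (xs - z) + gamma *: (us - t)).
    by rewrite normD_sqr dotZr mulrA addrAC.
  by rewrite !scalerBr addrACA -opprD -zt opprD addrACA.
rewrite dotZr; suff -> : dot (xs - x) (us - y) = 0 by rewrite mulr0.
by rewrite dotBl !dotBr Vus// Vus// Vy// Vy// !subr0.
Qed.

End OneStep.
End Projection.

(** * The contraction factor *)

Section ContractionFactor.
Variables (R : realFieldType) (eta L gamma : R).
Hypotheses (eta_gt0 : 0 < eta) (gamma_gt0 : 0 < gamma).

Let D := (1 + gamma * L) ^+ 2 - 2 * gamma * (L - eta).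

(** The terms [2 gamma L] cancel, which makes the sign of [D] and the bound [2 gamma eta <= D]
    visible. *)
Let D_eq : D = 1 + (gamma * L) ^+ 2 + 2 * gamma * eta.
Proof. by rewrite /D; ring. Qed.

Let gL2_ge0 : 0 <= (gamma * L) ^+ 2. Proof. exact: sqr_ge0. Qed.

Let ge_gt0 : 0 < gamma * eta. Proof. exact: mulr_gt0. Qed.

Let D_gt0 : 0 < D. Proof.
by rewrite D_eq -addrA ltr_pwDl// addr_ge0// -mulrA mulr_ge0// ltW.
Qed.

Lemma rate_ge0 : 0 <= 1 - 2 * gamma * eta / D.
Proof.
rewrite subr_ge0 ler_pdivrMr// mul1r D_eq lerDr.
by rewrite addr_ge0 ?ler01.
Qed.

(* [a2], [b2] and [t] stand for [|a|^2], [|b|^2] and [<a, b>]. *)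
Lemma rate_bound (a2 b2 t : R) : eta * a2 <= t -> b2 <= L ^+ 2 * a2 ->
  a2 + gamma ^+ 2 * b2 <=
  (1 - 2 * gamma * eta / D) * (a2 + gamma ^+ 2 * b2 + 2 * gamma * t).
Proof.
move=> ta ba; set S := _ + 2 * gamma * t.
suff : 2 * gamma * eta / D * S <= 2 * gamma * t.
  by rewrite mulrBl mul1r /S; lra.
rewrite mulrAC ler_pdivrMr// -!mulrA ler_pM2l// ler_pM2l// -subr_ge0.
(* The difference is a nonnegative combination of the slacks in strong monotonicity and in the
   Lipschitz bound. *)
have -> : t * D - eta * S = (t - eta * a2) * (1 + (gamma * L) ^+ 2)
    + eta * (gamma ^+ 2 * (L ^+ 2 * a2 - b2)).
  by rewrite D_eq /S; ring.
rewrite addr_ge0// mulr_ge0 ?subr_ge0 ?addr_ge0 ?ler01// ?(ltW eta_gt0)//.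
by rewrite mulr_ge0 ?sqr_ge0 ?subr_ge0.
Qed.

End ContractionFactor.

Theorem theorem2p4 (R : realType) (H : completeNormedModType R)
    (dot : {dot H for (@idfun R)}) (Hdot : norm_induced_by dot)
    (V : set H) (HV : closed_subspace V)
    (T : H -> set H) (HT : maximal_monotone dot T)
    (eta L : R) (eta_gt0 : 0 < eta) (L_gt0 : 0 < L)
    (T_strong : forall z z' v v', T z v -> T z' v' ->
       eta * `|z - z'| ^+ 2 <= dot (z - z') (v - v'))
    (T_lip : forall z z' v v', T z v -> T z' v' ->
       `|v - v'| <= L * `|z - z'|)
    (x0 y0 : H) (Hx0 : V x0) (Hy0 : orthogonal_complement dot V y0)
    (gamma : R) (gamma_gt0 : 0 < gamma)
    (x y xt u : nat -> H)
    (Hgen : spdg_generated dot V T gamma x0 y0 x y xt u)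
    (xs us : H) (Hxs : V xs) (Hus : orthogonal_complement dot V us)
    (HTs : T xs us) :
  let d0 := Num.sqrt (`|xs - x0| ^+ 2 + gamma ^+ 2 * `|us - y0| ^+ 2) in
  let rate := 1 - (2 * gamma * eta) /
                  ((1 + gamma * L) ^+ 2 - 2 * gamma * (L - eta)) in
  let PV := orthogonal_projection dot V in
  let PVperp := orthogonal_projection dot (orthogonal_complement dot V) in
  forall k : nat, (1 <= k)%N ->
  [/\ spdg_executed dot V xt u k.+1 ->
        `|x k.-1 - x k| ^+ 2 + gamma ^+ 2 * `|y k.-1 - y k| ^+ 2
          <= rate ^+ k.-1 * d0 ^+ 2,
      spdg_executed dot V xt u k ->
        `|xt k - PV (xt k)| ^+ 2 + gamma ^+ 2 * `|u k - PVperp (u k)| ^+ 2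
          <= rate ^+ k.-1 * d0 ^+ 2
    & spdg_executed dot V xt u k.+1 ->
        `|xs - x k| ^+ 2 + gamma ^+ 2 * `|us - y k| ^+ 2
          <= rate ^+ k * d0 ^+ 2].
Proof.
move=> d0 rate PV PVperp.
have sum_ge0 (a b : R) : 0 <= a ^+ 2 + gamma ^+ 2 * b ^+ 2.
  by rewrite -exprMn addr_ge0 ?sqr_ge0.
have d0E : d0 ^+ 2 = `|xs - x0| ^+ 2 + gamma ^+ 2 * `|us - y0| ^+ 2.
  by rewrite sqr_sqrtr.
case: Hgen => x_0 y_0 xt_step u_step x_step y_step.
have executed_le j k : (j <= k)%N -> spdg_executed dot V xt u k ->
    spdg_executed dot V xt u j.
  move=> jk ex i /andP[i1 ij]; apply: ex; rewrite i1.
  exact: leq_trans ij jk.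
pose s k := `|xs - x k| ^+ 2 + gamma ^+ 2 * `|us - y k| ^+ 2.
have xt_u k : (1 <= k)%N -> spdg_executed dot V xt u k ->
    xt k + gamma *: u k = x k.-1 + gamma *: y k.-1 /\ T (xt k) (u k).
  move=> k1 ex; have uE := u_step k k1 ex.
  split; first by rewrite uE scalerA divff ?gt_eqF// scale1r addrC subrK.
  (* The resolvent supplies [v] in [T (xt k)] with [gamma v] equal to the residual, so [v] is
     [u k]. *)
  have [v Tv vE] := xt_step k k1 ex.
  by rewrite uE -vE scalerA mulVf ?gt_eqF// scale1r.
(* Stated with projections instead of [x k] and [y k], which are unconstrained if the algorithm
   stops at [k]; the second bound must hold there too. *)
have step k : (1 <= k)%N -> spdg_executed dot V xt u k ->
    V (x k.-1) -> orthogonal_complement dot V (y k.-1) ->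
    `|xt k - PV (xt k)| ^+ 2 + gamma ^+ 2 * `|u k - PVperp (u k)| ^+ 2 <= s k.-1 /\
    `|xs - PV (xt k)| ^+ 2 + gamma ^+ 2 * `|us - PVperp (u k)| ^+ 2 <= rate * s k.-1.
  move=> k1 ex Vx Vy; have [sumE Tu] := xt_u k k1 ex.
  have gain := T_strong _ _ _ _ HTs Tu.
  have lip : `|us - u k| ^+ 2 <= L ^+ 2 * `|xs - xt k| ^+ 2.
    by rewrite -exprMn ler_pXn2r ?nnegrE ?mulr_ge0 ?(ltW L_gt0)//; apply: T_lip.
  have gain_ge0 : 0 <= 2 * gamma * dot (xs - xt k) (us - u k).
    rewrite !mulr_ge0 ?(ltW gamma_gt0)//; apply: le_trans gain.
    by rewrite mulr_ge0 ?sqr_ge0 ?(ltW eta_gt0).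
  have distE := step_distance Hdot HV gamma (xt k) (u k) Hxs Hus.
  rewrite /s (distance_expand Hdot Vx Vy sumE Hxs Hus); split.
    apply: le_trans (_ : _ <= `|xs - xt k| ^+ 2 + gamma ^+ 2 * `|us - u k| ^+ 2) _.
      by rewrite -distE lerDr.
    by rewrite lerDl.
  apply: le_trans (rate_bound eta_gt0 gamma_gt0 gain lip).
  by rewrite -distE lerDl.
(* Execution of iteration [k.+1] is what guarantees that [x k] and [y k] were produced; for [k = 0]
   they are the initial data. *)
have inv k : spdg_executed dot V xt u k.+1 ->
    [/\ V (x k), orthogonal_complement dot V (y k) & s k <= rate ^+ k * d0 ^+ 2].
  elim: k => [_|k IHk ex].
    by rewrite /s x_0 y_0 expr0 mul1r d0E; split.
  have ex' := executed_le _ _ (leqnSn _) ex; have [Vx Vy sk] := IHk ex'.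
  have [_ le_s] := step k.+1 isT ex' Vx Vy.
  rewrite /s (x_step k.+1 isT ex) (y_step k.+1 isT ex); split.
  - by case: (orthogonal_projectionP Hdot HV (xt k.+1)).
  - rewrite (orthogonal_projection_perp Hdot HV).
    by case: (orthogonal_projectionP Hdot HV (u k.+1)).
  (* Multiplying the induction hypothesis by [rate] preserves the inequality because [rate] is
     nonnegative. *)
  - apply: le_trans le_s _; rewrite exprS -mulrA ler_wpM2l//.
    exact: rate_ge0.
case=> // k _ /=.
have bound2 : spdg_executed dot V xt u k.+1 ->
    `|xt k.+1 - PV (xt k.+1)| ^+ 2 + gamma ^+ 2 * `|u k.+1 - PVperp (u k.+1)| ^+ 2
      <= rate ^+ k * d0 ^+ 2.
  move=> ex; have [Vx Vy sk] := inv k ex.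
  by have [le_s _] := step k.+1 isT ex Vx Vy; apply: le_trans sk.
split=> // ex; last by case: (inv k.+1 ex).
have ex' := executed_le _ _ (leqnSn _) ex; have [Vx Vy _] := inv k ex'.
rewrite (x_step k.+1 isT ex) (y_step k.+1 isT ex).
have [sumE _] := xt_u k.+1 isT ex'.
by rewrite (step_norm Hdot HV Vx Vy sumE); apply: bound2.
Qed.
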